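(* Let $\gamma=\frac{49\sqrt[3]{3}}{72}$. Then $$\limsup_{\substack{y\to\infty\\ y\ \mathrm{even}}}\frac{\mathfrak r(y)}{y^{2/3}}=\limsup_{\substack{y\to\infty\\ y\ \mathrm{odd}}}\frac{\mathfrak r(y)}{y^{2/3}}=\gamma,$$ where $y$ ranges over positive integers of the indicated parity.
   Context: The function $E$ on nonnegative integers is defined by $E(0)=0$, $E(1)=\frac43$, $E(2v)=E(v)$ and $E(2v+1)=E(v)+\frac43(v+1)$ for integers $v\ge0$. For a positive integer $y$, $$\mathfrak r(y)=\min_{0\le r\le\lfloor y/2\rfloor}\left\{\tfrac83\left(r-\tfrac{3y}{8}\right)^2+E(r)\right\},$$ the minimum being over integers $r$. *)

(* Defs.v *)
(* Stdlib real numbers, with Coquelicot for limits superior. *)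
From Stdlib Require Import Reals Lra Lia Arith PArith NArith.
From Coquelicot Require Import Coquelicot.
Open Scope R_scope.

(* [xO q] is 2q and [xI q] is 2q+1, so the clauses are the defining recurrences
   of E at positive arguments. *)
Fixpoint Epos (p : positive) : R :=
  match p with
  | xH => 4 / 3
  | xO q => Epos q
  | xI q => Epos q + 4 / 3 * (INR (Pos.to_nat q) + 1)
  end.

Definition E (n : nat) : R :=
  match N.of_nat n with
  | N0 => 0
  | Npos p => Epos p
  end.

Lemma E_0 : E 0 = 0.
Proof. reflexivity. Qed.

Lemma E_1 : E 1 = 4 / 3.
Proof. reflexivity. Qed.

Lemma E_even (v : nat) : E (2 * v) = E v.
Proof.
  unfold E; rewrite Nnat.Nat2N.inj_mul.
  now destruct (N.of_nat v).
Qed.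

Lemma E_odd (v : nat) : E (2 * v + 1) = E v + 4 / 3 * (INR v + 1).
Proof.
  unfold E; rewrite Nnat.Nat2N.inj_add, Nnat.Nat2N.inj_mul.
  destruct (N.of_nat v) as [|p] eqn:Hv.
  - replace v with 0%nat by lia. simpl. lra.
  - replace v with (Pos.to_nat p) by lia. reflexivity.
Qed.

(* Minimum of f 0, ..., f n (n + 1 terms). *)
Fixpoint min_upto (f : nat -> R) (n : nat) : R :=
  match n with
  | O => f O
  | S m => Rmin (min_upto f m) (f (S m))
  end.

Lemma min_upto_le (f : nat -> R) (n r : nat) : (r <= n)%nat -> min_upto f n <= f r.
Proof.
  induction n as [|n IH]; intros Hr; simpl.
  - replace r with 0%nat by lia. lra.
  - destruct (Nat.eq_dec r (S n)) as [->|Hne].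
    + apply Rmin_r.
    + eapply Rle_trans; [apply Rmin_l | apply IH; lia].
Qed.

Lemma min_upto_attained (f : nat -> R) (n : nat) :
  exists r, (r <= n)%nat /\ min_upto f n = f r.
Proof.
  induction n as [|n [r [Hr IH]]]; simpl.
  - now exists 0%nat.
  - destruct (Rle_dec (min_upto f n) (f (S n))) as [H|H].
    + exists r. split; [lia|]. now rewrite Rmin_left.
    + exists (S n). split; [lia|]. rewrite Rmin_right; lra.
Qed.

Definition frak_r (y : nat) : R :=
  min_upto (fun r => 8 / 3 * (INR r - 3 * INR y / 8) ^ 2 + E r) (y / 2).

(* [Rpower] is the real power only for a positive base; it is used at y >= 1. *)
Definition ratio (y : nat) : R := frak_r y / Rpower (INR y) (2 / 3).

Definition gamma : R := 49 * Rpower 3 (1 / 3) / 72.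

(* Main.v *)
(** Write y = (64/9) s^3, so that gamma * y^(2/3) = (98/27) s^2, and s = z 2^k with
    3/5 <= z <= 6/5. For the upper bound it suffices to try r = 2^k (4j + i),
    0 <= i <= 4, where the block [4j, 4j+4] contains 3y / (8 * 2^k): their costs depend
    only on E j and E (j+1), which satisfy E j <= (4/3) j and
    E (j+1) + 2 E j <= (8/3) j + 4/3, and one of the five is at most (98/27) s^2 + 4.
    The bound is sharp when z is near 1, j ends in many binary ones and 3y/8 lies
    (7/6) 2^k to the left of 2^k (4j+4): the last three of the five candidates then
    have equal costs to leading order, and no other r is cheaper. *)
Require Import Defs.
From Stdlib Require Import Reals Lra Lia Arith.
From Coquelicot Require Import Coquelicot.
Open Scope R_scope.

(** * Bounds on [E] from its binary recurrence *)

Lemma nat_parity_ind (P : nat -> Prop) :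
  P 0%nat -> (forall v, P v -> P (2 * v)%nat) -> (forall v, P v -> P (v + 1)%nat -> P (2 * v + 1)%nat) ->
  P 1%nat -> forall n, P n.
Proof.
  intros H0 He Ho H1 n.
  induction n as [n IH] using lt_wf_ind.
  destruct (Nat.Even_or_Odd n) as [[v ->]|[v ->]].
  - destruct v as [|v]; [exact H0|]. apply He, IH; lia.
  - destruct v as [|v]; [exact H1|]. apply Ho; apply IH; lia.
Qed.

Lemma INR_double (v : nat) : INR (2 * v) = 2 * INR v.
Proof. rewrite mult_INR; simpl; lra. Qed.

Lemma INR_double1 (v : nat) : INR (2 * v + 1) = 2 * INR v + 1.
Proof. rewrite plus_INR, mult_INR; simpl; lra. Qed.

Lemma INR_pow2 (k : nat) : INR (2 ^ k) = 2 ^ k.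
Proof. rewrite pow_INR; reflexivity. Qed.

Lemma E_nonneg (n : nat) : 0 <= E n.
Proof.
  induction n as [|v IH|v IH _|] using nat_parity_ind.
  - rewrite E_0; lra.
  - now rewrite E_even.
  - rewrite E_odd; pose proof (pos_INR v); lra.
  - rewrite E_1; lra.
Qed.

Lemma E_le (n : nat) : E n <= 4 / 3 * INR n.
Proof.
  induction n as [|v IH|v IH _|] using nat_parity_ind.
  - rewrite E_0; simpl; lra.
  - rewrite E_even, INR_double; pose proof (pos_INR v); lra.
  - rewrite E_odd, INR_double1; lra.
  - rewrite E_1; simpl; lra.
Qed.

(* If E n is close to its maximum 4n/3, then n ends in many ones, so n + 1 ends
   in many zeros and E (n + 1) is small. *)
Lemma E_succ_le (n : nat) : E (n + 1) + 2 * E n <= 8 / 3 * INR n + 4 / 3.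
Proof.
  induction n as [|v IH|v IH _|] using nat_parity_ind.
  - simpl Nat.add; rewrite E_0, E_1; simpl; lra.
  - rewrite E_odd, E_even, INR_double.
    pose proof (E_le v); pose proof (pos_INR v); lra.
  - replace (2 * v + 1 + 1)%nat with (2 * (v + 1))%nat by lia.
    rewrite E_odd, E_even, INR_double1; lra.
  - replace (1 + 1)%nat with (2 * 1)%nat by lia.
    rewrite E_even, E_1; simpl; lra.
Qed.

Lemma E_pow2_mul (k n : nat) : E (2 ^ k * n) = E n.
Proof.
  induction k as [|k IH]; [f_equal; simpl; lia|].
  rewrite Nat.pow_succ_r', <- Nat.mul_assoc, E_even; exact IH.
Qed.

(** In binary, 2^k m - 1 is m - 1 followed by k ones; the successive ones add (4/3) m 2^i for 0 <= i
    < k, a geometric sum. *)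
Lemma E_pow2_mul_pred (k m : nat) :
  (1 <= m)%nat -> E (2 ^ k * m - 1) = E (m - 1) + 4 / 3 * INR m * (2 ^ k - 1).
Proof.
  intros Hm; induction k as [|k IH].
  - replace (2 ^ 0 * m - 1)%nat with (m - 1)%nat by (simpl; lia). simpl; lra.
  - pose proof (Nat.pow_nonzero 2 k).
    replace (2 ^ S k * m - 1)%nat with (2 * (2 ^ k * m - 1) + 1)%nat
      by (rewrite Nat.pow_succ_r'; nia).
    rewrite E_odd, IH, minus_INR, mult_INR, INR_pow2 by nia.
    simpl; lra.
Qed.

Lemma E_shift_le (k q f : nat) : (f < 2 ^ k)%nat -> E q <= E (2 ^ k * q + f).
Proof.
  revert f; induction k as [|k IH]; intros f Hf.
  - replace (2 ^ 0 * q + f)%nat with q by (simpl in *; lia); lra.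
  - rewrite Nat.pow_succ_r' in *.
    destruct (Nat.Even_or_Odd f) as [[g ->]|[g ->]];
      assert (Hg : (g < 2 ^ k)%nat) by lia; specialize (IH g Hg).
    + replace (2 * 2 ^ k * q + 2 * g)%nat with (2 * (2 ^ k * q + g))%nat by lia.
      now rewrite E_even.
    + replace (2 * 2 ^ k * q + (2 * g + 1))%nat with (2 * (2 ^ k * q + g) + 1)%nat by lia.
      rewrite E_odd; pose proof (pos_INR (2 ^ k * q + g)); lra.
Qed.

(** At least one of the k digits appended to [q] is a one, and the prefix in front of it is at least
    [q]. *)
Lemma E_shift_pos_le (k q f : nat) :
  (0 < f < 2 ^ k)%nat -> E q + 4 / 3 * INR q <= E (2 ^ k * q + f).
Proof.
  revert f; induction k as [|k IH]; intros f Hf.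
  - simpl in Hf; lia.
  - rewrite Nat.pow_succ_r' in *.
    destruct (Nat.Even_or_Odd f) as [[g ->]|[g ->]].
    + replace (2 * 2 ^ k * q + 2 * g)%nat with (2 * (2 ^ k * q + g))%nat by lia.
      rewrite E_even; apply IH; lia.
    + replace (2 * 2 ^ k * q + (2 * g + 1))%nat with (2 * (2 ^ k * q + g) + 1)%nat by lia.
      rewrite E_odd.
      pose proof (E_shift_le k q g ltac:(lia)).
      assert (INR q <= INR (2 ^ k * q + g)).
      { apply le_INR. pose proof (Nat.pow_nonzero 2 k). nia. }
      lra.
Qed.

(** * The scale of y^(2/3) *)

Lemma gamma_scale (y : R) : 0 < y ->
  exists s, 0 < s /\ y = 64 / 9 * s ^ 3 /\ gamma * Rpower y (2 / 3) = 98 / 27 * s ^ 2.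
Proof.
  intros Hy.
  assert (cube : forall a, 0 < a -> Rpower a (1 / 3) ^ 3 = a).
  { intros a Ha. rewrite <- Rpower_pow by apply exp_pos.
    rewrite Rpower_mult. replace (1 / 3 * INR 3) with 1 by (simpl; lra).
    now apply Rpower_1. }
  set (c := Rpower 3 (1 / 3)); set (q := Rpower y (1 / 3)).
  assert (Hc : c ^ 3 = 3) by (apply cube; lra).
  assert (Hq : q ^ 3 = y) by (now apply cube).
  assert (Hc0 : 0 < c) by apply exp_pos.
  assert (Hq0 : 0 < q) by apply exp_pos.
  assert (Hq2 : Rpower y (2 / 3) = q ^ 2).
  { unfold q. rewrite <- Rpower_pow by apply exp_pos.
    rewrite Rpower_mult. f_equal. simpl; lra. }
  (* This is the cube root of 9y/64. *)
  exists (c ^ 2 * q / 4). repeat split.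
  - pose proof (pow_lt c 2 Hc0); nra.
  - replace (64 / 9 * (c ^ 2 * q / 4) ^ 3) with (c ^ 3 * c ^ 3 * q ^ 3 / 9) by field.
    rewrite Hc, Hq; field.
  - rewrite Hq2; unfold gamma; fold c.
    replace (98 / 27 * (c ^ 2 * q / 4) ^ 2) with (49 / 216 * c ^ 3 * c * q ^ 2) by field.
    rewrite Hc; field.
Qed.

Lemma Rpower_two_thirds_ge (y K : R) : 0 < K -> K ^ 3 <= y -> K ^ 2 <= Rpower y (2 / 3).
Proof.
  intros HK Hy.
  replace (K ^ 2) with (Rpower (K ^ 3) (2 / 3)).
  - apply Rle_Rpower_l; [lra|]. split; [now apply pow_lt | exact Hy].
  - rewrite <- !Rpower_pow, Rpower_mult by assumption. f_equal. simpl; lra.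
Qed.

(** * Upper bound: choosing among five candidates *)

(** For z <= 1 the two costs of an adjacent even and odd candidate suffice: after rescaling, [E]
    contributes at most (16/9) z^3 at even ones and (32/9) z^3 at odd ones, and [d] is the distance
    to the even one. *)
Lemma even_odd_cover (z d : R) : 3 / 5 <= z <= 1 -> 0 <= d <= 1 ->
  8 / 3 * d ^ 2 + 4 / 3 * (4 / 3 * z ^ 3) <= 98 / 27 * z ^ 2 \/
  8 / 3 * (1 - d) ^ 2 + 4 / 3 * (8 / 3 * z ^ 3) <= 98 / 27 * z ^ 2.
Proof.
  intros Hz Hd.
  (* The two costs agree at d = 1/2 + z^3/3. This is the required bound there, times 27/2; it is an
     equality at z = 1. *)
  assert (Hp : 0 <= 49 * z ^ 2 - 36 * z ^ 3 - 4 * z ^ 6 - 9).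
  { replace (49 * z ^ 2 - 36 * z ^ 3 - 4 * z ^ 6 - 9) with
      ((1 - z) * (4 * z ^ 3 * (z ^ 2 + z + 1) + (z - 3 / 5) * (40 * z + 15))) by field.
    apply Rmult_le_pos; [lra|]. apply Rplus_le_le_0_compat; apply Rmult_le_pos; try lra.
    - pose proof (pow_lt z 3); lra.
    - nra. }
  pose proof (pow_lt z 3 ltac:(lra)) as Hz3.
  assert (Hz6 : z ^ 6 = z ^ 3 * z ^ 3) by ring.
  destruct (Rle_dec d (1 / 2 + z ^ 3 / 3)) as [H|H].
  - left. assert (d ^ 2 <= (1 / 2 + z ^ 3 / 3) ^ 2) by (apply pow_incr; lra). nra.
  - right. assert ((1 - d) ^ 2 <= (1 / 2 - z ^ 3 / 3) ^ 2) by (apply pow_incr; lra). nra.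
Qed.

(* Here [t] is the position of [3y/8] in a block of length [4 * 2^k], [b] the
   number of the block, [e], [e'] the values of [E] at both ends of the block, all
   rescaled. The bound is attained at [z = 1], [t = 17/6], [e = 4/3 * b], [e' = 0],
   where the last three alternatives are equalities. *)
Lemma five_candidates (z t b e e' : R) :
  3 / 5 <= z <= 6 / 5 -> 0 <= t <= 4 -> 0 <= b <= 2 / 3 * z ^ 3 ->
  e <= 4 / 3 * b -> e' <= 4 / 3 * b -> e' + 2 * e <= 8 / 3 * b ->
  8 / 3 * t ^ 2 + e <= 98 / 27 * z ^ 2 \/
  8 / 3 * (t - 1) ^ 2 + (e + 8 / 3 * b) <= 98 / 27 * z ^ 2 \/
  8 / 3 * (t - 2) ^ 2 + (e + 4 / 3 * b) <= 98 / 27 * z ^ 2 \/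
  8 / 3 * (t - 3) ^ 2 + (e + 4 * b) <= 98 / 27 * z ^ 2 \/
  8 / 3 * (t - 4) ^ 2 + e' <= 98 / 27 * z ^ 2.
Proof.
  intros Hz Ht Hb He He' Hee.
  assert (Hz3 : 0 < z ^ 3) by (apply pow_lt; lra).
  destruct (Rle_dec z 1) as [Hz1|Hz1].
  - destruct (Rle_dec t 1).
    { destruct (even_odd_cover z t) as [H|H]; [lra | lra | left; lra | right; left; lra]. }
    destruct (Rle_dec t 2).
    { destruct (even_odd_cover z (2 - t)) as [H|H];
        [lra | lra | right; right; left; lra | right; left; lra]. }
    destruct (Rle_dec t 3).
    { destruct (even_odd_cover z (t - 2)) as [H|H];
        [lra | lra | right; right; left; lra | right; right; right; left; lra]. }
    destruct (even_odd_cover z (4 - t)) as [H|H];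
      [lra | lra | do 4 right; lra | right; right; right; left; lra].
  (* [Hend] serves the block ends at distance at most 1, [Hmid] the middle candidate at distance at
     most 5/6. Only 17/6 < t < 3 needs the joint bound on [e] and [e']. *)
  - assert (Hend : 8 / 3 + 8 / 9 * z ^ 3 <= 98 / 27 * z ^ 2).
    { assert (0 <= (z - 1) * (2 - z) * (z + 1)) by (repeat apply Rmult_le_pos; lra).
      nra. }
    assert (Hmid : 50 / 27 + 16 / 9 * z ^ 3 <= 98 / 27 * z ^ 2).
    { assert (0 <= (z - 1) * (50 / 27 + 50 / 27 * z - 16 / 9 * z ^ 2))
        by (apply Rmult_le_pos; nra).
      nra. }
    destruct (Rle_dec t 1).
    { left. assert (t ^ 2 <= 1) by nra. lra. }
    destruct (Rle_dec t (7 / 6)).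
    { right; left. assert ((t - 1) ^ 2 <= 1 / 36) by nra.
      assert (z ^ 3 <= 6 / 5 * z ^ 2) by nra. nra. }
    destruct (Rle_dec t (17 / 6)).
    { right; right; left. assert ((t - 2) ^ 2 <= 25 / 36) by nra. lra. }
    destruct (Rle_dec 3 t).
    { do 4 right. assert ((t - 4) ^ 2 <= 1) by nra. lra. }
    do 2 right.
    destruct (Rle_dec (8 / 3 * (t - 2) ^ 2 + (e + 4 / 3 * b)) (98 / 27 * z ^ 2)) as [|N2]; [now left|].
    destruct (Rle_dec (8 / 3 * (t - 3) ^ 2 + (e + 4 * b)) (98 / 27 * z ^ 2)) as [|N3]; [now right; left|].
    right; right. apply Rnot_lt_le; intros N4.
    apply Rnot_le_lt in N2; apply Rnot_le_lt in N3.
    (* Adding twice N2, respectively twice N3, to N4 eliminates e and e'. *)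
    assert (A : 0 < 6 * t ^ 2 - 32 * t + 48 + 8 / 3 * z ^ 3 - 49 / 6 * z ^ 2) by lra.
    assert (B : 0 < 6 * t ^ 2 - 40 * t + 68 + 16 / 3 * z ^ 3 - 49 / 6 * z ^ 2) by lra.
    clear N2 N3 N4 He He' Hee Hb Hmid Hend.
    (* For 17/6 <= t <= 3 the right side of [A] increases in t and that of [B] decreases; both
       vanish at t = 17/6, z = 1. So [B] is refuted for the smaller z and [A] for the larger, with a
       cut in z that depends on the range of t. *)
    destruct (Rle_dec t (29 / 10)).
    + destruct (Rle_dec z (51 / 50)).
      * assert (0 <= (t - 17 / 6) * (23 - 6 * t)) by (apply Rmult_le_pos; lra).
        assert (0 <= (z - 1) * (17 / 6 * z + 17 / 6 - 16 / 3 * z ^ 2))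
          by (apply Rmult_le_pos; nra).
        lra.
      * assert (0 <= (29 / 10 - t) * (6 * t - 73 / 5)) by (apply Rmult_le_pos; lra).
        assert (0 <= (z - 51 / 50) *
                  (49 / 6 * (z + 51 / 50) - 8 / 3 * (z ^ 2 + 51 / 50 * z + (51 / 50) ^ 2)))
          by (apply Rmult_le_pos; nra).
        lra.
    + destruct (Rle_dec z (11 / 10)).
      * assert (0 <= (t - 29 / 10) * (113 / 5 - 6 * t)) by (apply Rmult_le_pos; lra).
        assert (0 <= (z - 1) * (17 / 6 * z + 23 / 6 - 16 / 3 * z ^ 2))
          by (apply Rmult_le_pos; nra).
        lra.
      * assert (0 <= (3 - t) * (6 * t - 14)) by (apply Rmult_le_pos; lra).
        assert (0 <= (6 / 5 - z) * z ^ 2) by (apply Rmult_le_pos; nra).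
        nra.
Qed.

Lemma dyadic_scale (a s : R) : 0 < a <= s -> exists k, a * 2 ^ k <= s <= 2 * a * 2 ^ k.
Proof.
  intros Ha.
  assert (Hn : exists n, s < a * 2 ^ n).
  { destruct (Pow_x_infinity 2 ltac:(rewrite Rabs_pos_eq; lra) (s / a + 1)) as [n Hn].
    exists n. specialize (Hn n (le_n n)).
    rewrite Rabs_pos_eq in Hn by (apply pow_le; lra).
    replace s with (a * (s / a)) by (field; lra).
    apply Rmult_lt_compat_l; lra. }
  destruct Hn as [n Hn]; induction n as [|n IH]; simpl in Hn; [lra|].
  destruct (Rlt_dec s (a * 2 ^ n)) as [H|H]; [now apply IH|].
  exists n; lra.
Qed.

Lemma frak_r_le (y : nat) (s : R) :
  3 <= s -> INR y = 64 / 9 * s ^ 3 -> frak_r y <= 98 / 27 * s ^ 2 + 4.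
Proof.
  intros Hs Hy.
  destruct (dyadic_scale (3 / 5) s ltac:(lra)) as [k Hk].
  set (K := 2 ^ k) in *.
  assert (HK : 1 <= K) by (apply pow_R1_Rle; lra).
  set (z := s / K).
  assert (Hz : s = z * K) by (unfold z; field; lra).
  assert (Hz1 : 3 / 5 <= z <= 6 / 5).
  { split; apply Rmult_le_reg_r with K; lra. }
  assert (Hz3 : 0 < z ^ 3) by (apply pow_lt; lra).
  (* The target 3y/8 in units of K. *)
  set (tau := 8 / 3 * z ^ 3 * K ^ 2).
  assert (Hx : 3 * INR y / 8 = K * tau).
  { rewrite Hy, Hz; unfold tau; field. }
  assert (HK2 : 0 < K ^ 2) by (apply pow_lt; lra).
  assert (Htau : 0 <= tau) by (apply Rmult_le_pos; lra).
  destruct (nfloor_ex (tau / 4) ltac:(lra)) as [j Hj].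
  assert (Hcand : forall i : nat, (i <= 4)%nat ->
    8 / 3 * (tau - (4 * INR j + INR i)) ^ 2 + E (4 * j + i) / K ^ 2
      <= 98 / 27 * z ^ 2 + 4 / K ^ 2 ->
    frak_r y <= 98 / 27 * s ^ 2 + 4).
  { intros i Hi Hc.
    eapply Rle_trans; [apply (min_upto_le _ _ (2 ^ k * (4 * j + i)))|].
    (* Since r <= 3y/8 + 4K, the constraint r <= y/2 follows from y >= 32K, which holds because s >=
       3 and K <= (5/3) s. *)
    - assert (Hr : INR (2 * (2 ^ k * (4 * j + i))) <= INR y).
      { apply le_INR in Hi; simpl in Hi.
        rewrite !mult_INR, plus_INR, mult_INR, INR_pow2; fold K; simpl INR at 1 2.
        assert (K * ((1 + 1 + 1 + 1) * INR j + INR i) <= K * (tau + 4))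
          by (apply Rmult_le_compat_l; lra).
        assert (32 * K <= INR y) by (rewrite Hy; nra).
        lra. }
      apply INR_le in Hr. apply Nat.div_le_lower_bound; lia.
    - rewrite E_pow2_mul, Hx, mult_INR, plus_INR, mult_INR, INR_pow2; fold K.
      replace (INR 4) with 4 by (simpl; lra).
      apply Rmult_le_compat_r with (r := K ^ 2) in Hc; [|lra].
      rewrite Hz.
      replace (98 / 27 * (z * K) ^ 2 + 4) with ((98 / 27 * z ^ 2 + 4 / K ^ 2) * K ^ 2)
        by (field; lra).
      eapply Rle_trans; [|exact Hc]. right; field; lra. }
  assert (Hdiv : forall a b, a <= b -> a / K ^ 2 <= b / K ^ 2).
  { intros a b Hab. apply Rmult_le_compat_r; [left; now apply Rinv_0_lt_compat | exact Hab]. }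
  assert (HiK : 0 < / K ^ 2) by now apply Rinv_0_lt_compat.
  (* Subtracting 4/3 in [e'] removes the additive constants from the bounds on [E (j + 1)]. The
     constants return in the five costs, where the largest is 4. *)
  set (b := INR j / K ^ 2). set (e := E j / K ^ 2). set (e' := (E (j + 1) - 4 / 3) / K ^ 2).
  assert (Hb : 0 <= b <= 2 / 3 * z ^ 3).
  { split; [apply Rmult_le_pos; [apply pos_INR | lra]|].
    replace (2 / 3 * z ^ 3) with (tau / 4 / K ^ 2) by (unfold tau; field; lra).
    apply Hdiv; lra. }
  assert (He : e <= 4 / 3 * b).
  { unfold b. replace (4 / 3 * (INR j / K ^ 2)) with (4 / 3 * INR j / K ^ 2) by (field; lra).
    apply Hdiv, E_le. }
  assert (He' : e' <= 4 / 3 * b).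
  { unfold b. replace (4 / 3 * (INR j / K ^ 2)) with (4 / 3 * INR j / K ^ 2) by (field; lra).
    apply Hdiv. pose proof (E_le (j + 1)) as H; rewrite plus_INR in H; simpl in H; lra. }
  assert (Hee : e' + 2 * e <= 8 / 3 * b).
  { unfold b, e, e'.
    replace (8 / 3 * (INR j / K ^ 2)) with (8 / 3 * INR j / K ^ 2) by (field; lra).
    replace ((E (j + 1) - 4 / 3) / K ^ 2 + 2 * (E j / K ^ 2))
      with ((E (j + 1) - 4 / 3 + 2 * E j) / K ^ 2) by (field; lra).
    apply Hdiv. pose proof (E_succ_le j); lra. }
  assert (E1 : E (4 * j + 1) = E j + 8 / 3 * INR j + 4 / 3).
  { replace (4 * j + 1)%nat with (2 * (2 * j) + 1)%nat by lia.
    rewrite E_odd, E_even, INR_double; lra. }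
  assert (E2 : E (4 * j + 2) = E j + 4 / 3 * INR j + 4 / 3).
  { replace (4 * j + 2)%nat with (2 * (2 * j + 1))%nat by lia.
    rewrite E_even, E_odd; lra. }
  assert (E3 : E (4 * j + 3) = E j + 4 * INR j + 4).
  { replace (4 * j + 3)%nat with (2 * (2 * j + 1) + 1)%nat by lia.
    rewrite E_odd, E_odd, INR_double1; lra. }
  assert (E0 : E (4 * j + 0) = E j).
  { replace (4 * j + 0)%nat with (2 ^ 2 * j)%nat by (simpl; lia). apply E_pow2_mul. }
  assert (E4 : E (4 * j + 4) = E (j + 1)).
  { replace (4 * j + 4)%nat with (2 ^ 2 * (j + 1))%nat by (simpl; lia). apply E_pow2_mul. }
  destruct (five_candidates z (tau - 4 * INR j) b e e' Hz1 ltac:(lra) Hb He He' Hee)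
    as [H|[H|[H|[H|H]]]].
  - apply (Hcand 0%nat); [lia|]. rewrite E0; fold e. simpl INR. lra.
  - apply (Hcand 1%nat); [lia|]. rewrite E1.
    replace ((E j + 8 / 3 * INR j + 4 / 3) / K ^ 2) with (e + 8 / 3 * b + 4 / 3 * / K ^ 2)
      by (unfold e, b; field; lra).
    simpl INR. lra.
  - apply (Hcand 2%nat); [lia|]. rewrite E2.
    replace ((E j + 4 / 3 * INR j + 4 / 3) / K ^ 2) with (e + 4 / 3 * b + 4 / 3 * / K ^ 2)
      by (unfold e, b; field; lra).
    simpl INR. lra.
  - apply (Hcand 3%nat); [lia|]. rewrite E3.
    replace ((E j + 4 * INR j + 4) / K ^ 2) with (e + 4 * b + 4 * / K ^ 2)
      by (unfold e, b; field; lra).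
    simpl INR. lra.
  - apply (Hcand 4%nat); [lia|]. rewrite E4.
    replace (E (j + 1) / K ^ 2) with (e' + 4 / 3 * / K ^ 2) by (unfold e'; field; lra).
    simpl INR. lra.
Qed.

(** * Lower bound: inputs with no cheap candidate *)

(* K^2 m - (7/6) K is the extremal position for 3y/8. With q = r / K and Q = m K,
   the cases q >= Q, q = Q - 1, and r = K (Q - 2) or q = Q - 3 are sharp to leading
   order. *)
Lemma cost_ge (k m r : nat) (x : R) :
  let K := 2 ^ S k in
  8 <= K -> 8 / 3 * K - 1 <= INR m ->
  Rabs (x - (INR m * K ^ 2 - 7 / 6 * K)) <= 1 ->
  98 / 27 * K ^ 2 - 9 * K <= 8 / 3 * (INR r - x) ^ 2 + E r.
Proof.
  intros K HK Hm Hx. apply Rabs_le_between in Hx.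
  set (N := (2 ^ S k)%nat).
  assert (HN : INR N = K) by apply INR_pow2.
  assert (HN8 : (8 <= N)%nat) by (apply INR_le; rewrite HN; simpl; lra).
  assert (Hm1 : (1 <= m)%nat) by (apply INR_le; simpl; lra).
  set (Q := (m * N)%nat).
  assert (HQ : INR Q = INR m * K) by (unfold Q; now rewrite mult_INR, HN).
  assert (HQ8 : (8 <= Q)%nat) by (unfold Q; nia).
  pose proof (Nat.div_mod_eq r N) as Hr.
  pose proof (Nat.mod_upper_bound r N ltac:(lia)) as Hf.
  set (q := (r / N)%nat) in *; set (f := (r mod N)%nat) in *.
  assert (HrR : INR r = K * INR q + INR f) by (rewrite Hr, plus_INR, mult_INR, HN; ring).
  assert (HfR : 0 <= INR f < K) by (split; [apply pos_INR | rewrite <- HN; now apply lt_INR]).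
  pose proof (E_nonneg r) as Er.
  assert (Hshift : E q <= E r) by (rewrite Hr; now apply E_shift_le).
  assert (HmK : 8 / 3 * K ^ 2 - K <= INR m * K) by nra.
  assert (sq : forall d u, 0 <= u -> (u <= d \/ u <= - d) -> u ^ 2 <= d ^ 2).
  { intros d u Hu [H|H]; nra. }
  (* The exponent [S k] makes Q even, and its half is again a power of two times m, so E (Q - 2) = E
     (P - 1) is also large. *)
  assert (Hhalf : exists P, Q = (2 * P)%nat /\ E (P - 1) >= 4 / 3 * INR m * (K / 2 - 1)).
  { exists (2 ^ k * m)%nat. split; [unfold Q, N; rewrite Nat.pow_succ_r'; lia|].
    rewrite E_pow2_mul_pred by exact Hm1.
    pose proof (E_nonneg (m - 1)).
    replace (K / 2) with (2 ^ k) by (unfold K; simpl; lra). lra. }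
  destruct Hhalf as [P [HP HEP]].
  assert (HPR : INR Q = 2 * INR P) by (rewrite HP; apply INR_double).
  destruct (le_lt_dec Q q) as [H1|H1].
  (* The distance alone suffices, as (8/3)(7/6)^2 = 98/27. *)
  { apply le_INR in H1.
    assert (K * INR Q <= K * INR q) by (apply Rmult_le_compat_l; lra).
    pose proof (sq (INR r - x) (7 / 6 * K - 1) ltac:(lra) ltac:(left; nra)). nra. }
  destruct (le_lt_dec q (Q - 4)) as [H4|H4].
  { apply le_INR in H4; rewrite minus_INR in H4 by lia; simpl INR in H4.
    assert (K * INR q <= K * (INR Q - 4)) by (apply Rmult_le_compat_l; lra).
    pose proof (sq (INR r - x) (11 / 6 * K - 1) ltac:(lra) ltac:(right; nra)). nra. }
  assert (Hc : q = (Q - 1)%nat \/ q = (Q - 2)%nat \/ q = (Q - 3)%nat) by lia.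
  destruct Hc as [Hq|[Hq|Hq]];
    assert (HqR := f_equal INR Hq); rewrite minus_INR in HqR by lia; simpl INR in HqR.
  (* To leading order [E] gives (96/27) K^2, and the distance K/6 the remaining (2/27) K^2. *)
  - assert (E q >= 4 / 3 * INR m * (K - 1)).
    { rewrite Hq. unfold Q, N. rewrite Nat.mul_comm, E_pow2_mul_pred by exact Hm1.
      pose proof (E_nonneg (m - 1)). fold K. lra. }
    pose proof (sq (INR r - x) (1 / 6 * K - 1) ltac:(lra) ltac:(left; nra)). nra.
  - assert (Hqv : E q = E (P - 1)).
    { rewrite Hq, HP. replace (2 * P - 2)%nat with (2 * (P - 1))%nat by lia. apply E_even. }
    destruct (Nat.eq_dec f 0) as [Hf0|Hf0].
    + rewrite Hf0, HqR, HQ in HrR; simpl INR in HrR.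
      pose proof (sq (INR r - x) (5 / 6 * K - 1) ltac:(lra) ltac:(right; lra)). nra.
    (* Here [E r] alone is about (16/9 + 32/9) K^2, more than (98/27) K^2. *)
    + assert (E q + 4 / 3 * INR q <= E r) by (rewrite Hr; apply E_shift_pos_le; unfold N in *; lia).
      pose proof (pow2_ge_0 (INR r - x)). nra.
  - assert (E q >= 4 / 3 * (INR P - 1)).
    { rewrite Hq, HP. replace (2 * P - 3)%nat with (2 * (P - 2) + 1)%nat by lia.
      rewrite E_odd, minus_INR by lia. pose proof (E_nonneg (P - 2)). simpl INR. lra. }
    pose proof (sq (INR r - x) (5 / 6 * K - 1) ltac:(lra) ltac:(right; nra)). nra.
Qed.

(** Rounding the extremal y down to the form 2n + p moves 3y/8 by less than 3/4, within the
    tolerance 1 of [cost_ge]. The bound y <= (64/9) K^3 later gives gamma y^(2/3) <= (98/27) K^2. *)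
Lemma frak_r_ge_frequently (p N : nat) : (p <= 2)%nat ->
  exists (n : nat) (K : R), (N <= n)%nat /\ INR N + 8 <= K /\
    K ^ 3 <= INR (2 * n + p) <= 64 / 9 * K ^ 3 /\
    98 / 27 * K ^ 2 - 9 * K <= frak_r (2 * n + p).
Proof.
  intros Hp. apply le_INR in Hp; simpl in Hp. pose proof (pos_INR p) as Hp0.
  set (k := (N + 8)%nat); set (K := 2 ^ S k).
  pose proof (pos_INR N) as HN0.
  assert (HK : INR N + 8 <= K).
  { unfold K; rewrite <- INR_pow2. replace 8 with (INR 8) by (simpl; lra).
    rewrite <- plus_INR. apply le_INR.
    pose proof (Nat.pow_gt_lin_r 2 (S k) ltac:(lia)); unfold k in *; lia. }
  destruct (nfloor_ex (8 / 3 * K) ltac:(lra)) as [m Hm].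
  (* The real y for which 3y/8 is exactly the extremal position. *)
  set (Y := 8 / 3 * (INR m * K ^ 2 - 7 / 6 * K)).
  assert (HK2 : 8 * K <= K ^ 2) by nra.
  assert (HK3 : 8 * K ^ 2 <= K ^ 3) by nra.
  assert (HY : K ^ 3 + 2 <= Y <= 64 / 9 * K ^ 3).
  { assert ((8 / 3 * K - 1) * K ^ 2 <= INR m * K ^ 2 <= 8 / 3 * K * K ^ 2)
      by (split; apply Rmult_le_compat_r; lra).
    unfold Y; lra. }
  destruct (nfloor_ex ((Y - INR p) / 2) ltac:(lra)) as [n Hn].
  assert (Hy : INR (2 * n + p) = 2 * INR n + INR p) by (rewrite plus_INR, INR_double; lra).
  exists n, K. repeat split; try lra.
  - apply INR_le; lra.
  - unfold frak_r.
    destruct (min_upto_attained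
      (fun r => 8 / 3 * (INR r - 3 * INR (2 * n + p) / 8) ^ 2 + E r) ((2 * n + p) / 2))
      as [r [_ ->]].
    apply (cost_ge k m); fold K; [lra | lra |].
    apply Rabs_le_between; rewrite Hy; unfold Y in Hn; lra.
Qed.

(** * Passage to the limits superior *)

(** The residue p = 2 stands for even y, so that y = 0 never occurs. *)
Lemma LimSup_ratio (p : nat) : (1 <= p <= 2)%nat ->
  LimSup_seq (fun n : nat => ratio (2 * n + p)) = Finite gamma.
Proof.
  intros Hp. apply is_LimSup_seq_unique; intros [eps Heps]; cbn [pos]; split.
  - intros N.
    (* Forces K > 9/eps, so the loss 9K stays below eps K^2 <= eps y^(2/3). *)
    destruct (nfloor_ex (9 / eps)) as [L HL].
    { apply Rlt_le, Rdiv_lt_0_compat; lra. }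
    destruct (frak_r_ge_frequently p (N + L) ltac:(lia)) as [n [K [Hn [HK [Hy Hr]]]]].
    exists n; split; [lia|].
    rewrite plus_INR in HK. pose proof (pos_INR N); pose proof (pos_INR L).
    assert (HKe : 9 < eps * K).
    { replace 9 with (eps * (9 / eps)) by (field; lra). apply Rmult_lt_compat_l; lra. }
    pose proof (Rpower_two_thirds_ge _ K ltac:(lra) (proj1 Hy)) as HD.
    assert (HK3 : 0 < K ^ 3) by (apply pow_lt; lra).
    destruct (gamma_scale (INR (2 * n + p)) ltac:(lra)) as [s [Hs [Hys Hg]]].
    assert (HsK : s <= K).
    { apply Rnot_lt_le; intros H1.
      assert (K ^ 3 < s ^ 3) by (rewrite <- !Rpower_pow by lra; apply Rlt_Rpower_l; simpl; lra).
      rewrite Hys in Hy; lra. }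
    assert (s ^ 2 <= K ^ 2) by (apply pow_incr; lra).
    unfold ratio. set (D := Rpower (INR (2 * n + p)) (2 / 3)) in *.
    assert (HD0 : 0 < D) by apply exp_pos.
    apply Rmult_lt_reg_r with D; [exact HD0|].
    replace (frak_r (2 * n + p) / D * D) with (frak_r (2 * n + p)) by (field; lra).
    assert (eps * K ^ 2 <= eps * D) by (apply Rmult_le_compat_l; lra).
    assert (9 * K < eps * K ^ 2) by nra.
    lra.
  (* With y >= M^3, the 6 gives s >= 3 and the 4/eps makes the excess 4 less than eps y^(2/3). *)
  - set (M := Rmax 6 (4 / eps)).
    assert (HM : 6 <= M /\ 4 / eps <= M) by (split; [apply Rmax_l | apply Rmax_r]).
    destruct (nfloor_ex (M ^ 3) ltac:(apply pow_le; lra)) as [N HN].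
    exists N; intros n Hn.
    apply le_INR in Hn. pose proof (pos_INR n).
    assert (Hp1 : 1 <= INR p) by (apply (le_INR 1); lia).
    assert (Hy : M ^ 3 <= INR (2 * n + p)) by (rewrite plus_INR, INR_double; lra).
    pose proof (Rpower_two_thirds_ge _ M ltac:(lra) Hy) as HD.
    assert (HM3 : 6 ^ 3 <= M ^ 3) by (apply pow_incr; lra).
    destruct (gamma_scale (INR (2 * n + p)) ltac:(lra)) as [s [Hs [Hys Hg]]].
    assert (Hs3 : 3 <= s).
    { apply Rnot_lt_le; intros H1.
      assert (s ^ 3 <= 3 ^ 3) by (apply pow_incr; lra). lra. }
    pose proof (frak_r_le _ s Hs3 Hys) as Hr.
    unfold ratio. set (D := Rpower (INR (2 * n + p)) (2 / 3)) in *.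
    assert (HD0 : 0 < D) by apply exp_pos.
    apply Rmult_lt_reg_r with D; [exact HD0|].
    replace (frak_r (2 * n + p) / D * D) with (frak_r (2 * n + p)) by (field; lra).
    assert (4 <= eps * M).
    { replace 4 with (eps * (4 / eps)) by (field; lra). apply Rmult_le_compat_l; lra. }
    assert (M < M ^ 2) by nra.
    assert (eps * M < eps * D) by (apply Rmult_lt_compat_l; lra).
    lra.
Qed.

Theorem theorem5p5 :
  LimSup_seq (fun n : nat => ratio (2 * n + 2)) = Finite gamma /\
  LimSup_seq (fun n : nat => ratio (2 * n + 1)) = Finite gamma.
Proof.
  split; apply LimSup_ratio; lia.
Qed.
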